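(* If a semicascade $(\Omega,\varphi)$ is ordinary, then every ergodic operator net $T_\alpha\in G_0$ contains a convergent ergodic subsequence $T_{\alpha(k)}$ (convergence being understood in the $\mathrm{W}^*\mathrm{O}$-topology of $\mathrm{End}\,X^*$).
   Context: $\Omega$ is a metrizable compact space and $\varphi:\Omega\to\Omega$ is a continuous (not necessarily invertible) map; $(\Omega,\varphi)$ is the corresponding semicascade (discrete dynamical system $\{\varphi^n\}_{n\ge 0}$). $X=C(\Omega)$ is the Banach space of continuous scalar functions on $\Omega$, and $X^*$ is its dual, i.e. the space of Borel measures on $\Omega$, with pairing $(x,\mu)=\int_\Omega x\,d\mu$. $\mathrm{End}\,X$ and $\mathrm{End}\,X^*$ are the algebras of bounded linear operators. $U\in\mathrm{End}\,X$ is defined by $(Ux)(\omega)=x(\varphi\omega)$, $V=U^*\in\mathrm{End}\,X^*$, and $I$ is the identity. The $\mathrm{W}^*\mathrm{O}$-topology (weak$^*$ operator topology) on $\mathrm{End}\,X^*$: $T_\alpha\to T$ iff $(x,T_\alpha y)\to(x,Ty)$ for all $x\in X$, $y\in X^*$. $G_0=\mathrm{co}\{V^n: n\ge 0\}$ is the convex hull in $\mathrm{End}\,X^*$. A net (in particular, a sequence) of operators $T_\alpha\in G_0$ is called ergodic if $T_\alpha(I-V)\to 0$ in the $\mathrm{W}^*\mathrm{O}$-topology. The (Ellis) enveloping semigroup $E(\Omega,\varphi)$ is the closure of $\{\varphi^n: n\ge 0\}$ in $\Omega^\Omega$ with the topology of pointwise convergence. The semicascade is called ordinary if the compact space $E(\Omega,\varphi)$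 is metrizable. *)

(* Defs.v *)
From HB Require Import structures.
From mathcomp Require Import all_boot all_order all_algebra.
From mathcomp Require Import all_classical all_reals all_analysis.
From mathcomp Require complex.

Set Implicit Arguments.
Unset Strict Implicit.
Unset Printing Implicit Defensive.

Import Order.TTheory GRing.Theory Num.Theory.
Import numFieldNormedType.Exports.

Local Open Scope classical_set_scope.
Local Open Scope ring_scope.

Inductive scalar_kind := RealScalars | ComplexScalars.

Section scalars.
Import complex.

Definition scalars (R : realType) (s : scalar_kind) : numFieldType :=
  match s with
  | RealScalars => R
  | ComplexScalars => complex R
  end.

End scalars.

Definition metrizable (R : realType) (T : topologicalType) : Prop :=
  exists (M : metricType R) (f : T -> M) (g : M -> T),
    [/\ continuous f, continuous g, cancel f g & cancel g f].

Section enveloping_semigroup.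
Context (Omega : topologicalType) (phi : Omega -> Omega).

Definition enveloping_semigroup : set {ptws Omega -> Omega} :=
  closure (range (fun n : nat => iter n phi : {ptws Omega -> Omega})).

Definition ordinary (R : realType) : Prop :=
  metrizable R (set_type enveloping_semigroup).

End enveloping_semigroup.

(* Over a scalar field that may be complex the library has no suprema in which
   a sup norm or an operator norm could take its values, so a norm is
   represented by the relation "the norm of v is at most c". *)
Section bounded_linear_maps.
Context (K : numFieldType).

Definition abs_le (z : K^o) (c : K) : Prop := `|z| <= c.

Context (V W : lmodType K) (nV : V -> K -> Prop) (nW : W -> K -> Prop).

Definition op_norm_le (f : V -> W) (c : K) : Prop :=
  0 <= c /\ forall v b, nV v b -> nW (f v) (c * b).

Definition bounded_linear (f : V -> W) : Prop :=
  linear f /\ exists c, op_norm_le f c.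

End bounded_linear_maps.

Section continuous_functions.
Context (K : numFieldType) (Omega : topologicalType).

Definition continuous_pred : {pred Omega -> K^o} :=
  [pred x | `[< continuous x >]].

Record contfun := Contfun {
  contfun_val :> Omega -> K^o;
  contfunP : contfun_val \in continuous_pred
}.

HB.instance Definition _ := [isSub for contfun_val].
HB.instance Definition _ := [Choice of contfun by <:].

Lemma continuous_pred_submod_closed : submod_closed continuous_pred.
Proof.
split=> [|a x y /asboolP xc /asboolP yc]; apply/asboolP => w.
  exact: cvg_cst.
by apply: cvgD; [apply: cvgZr; exact: xc|exact: yc].
Qed.

HB.instance Definition _ := GRing.isSubmodClosed.Build _ _ continuous_pred
  continuous_pred_submod_closed.
HB.instance Definition _ := [SubChoice_isSubLmodule of contfun by <:].

(* The condition on c only matters when Omega is empty. *)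
Definition sup_norm_le (x : contfun) (c : K) : Prop :=
  0 <= c /\ forall w, `|x w| <= c.

End continuous_functions.

Section dual.
Context (K : numFieldType) (Omega : topologicalType).
Local Notation X := (contfun K Omega).

Definition dual_pred : {pred X -> K^o} :=
  [pred f | `[< bounded_linear (@sup_norm_le K Omega) (@abs_le K) f >]].

(* The Banach dual of C(Omega); by the Riesz theorem its elements are the
   (regular) Borel measures on Omega, and y x is the integral of x. *)
Record dual := Dual {
  dual_val :> X -> K^o;
  dualP : dual_val \in dual_pred
}.

HB.instance Definition _ := [isSub for dual_val].
HB.instance Definition _ := [Choice of dual by <:].

Lemma dual_pred_submod_closed : submod_closed dual_pred.
Proof.
split=> [|a f g /asboolP [fl [c [c0 fc]]] /asboolP [gl [d [d0 gd]]]].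
  apply/asboolP; split=> [a u v|].
    by rewrite scaler0 addr0.
  by exists 0; split=> // x b _; rewrite /abs_le normr0 mul0r.
apply/asboolP; split=> [b u v|].
  have afgE w : (a *: f + g) w = a *: f w + g w by [].
  by rewrite !afgE fl gl !scalerDr !scalerA addrACA [a * b]mulrC.
exists (`|a| * c + d); split=> [|x b xb].
  by rewrite addr_ge0// mulr_ge0.
rewrite /abs_le mulrDl (le_trans (ler_normD _ _))// lerD//; last exact: gd.
by rewrite normrM -mulrA ler_wpM2l//; exact: fc.
Qed.

HB.instance Definition _ := GRing.isSubmodClosed.Build _ _ dual_pred
  dual_pred_submod_closed.
HB.instance Definition _ := [SubChoice_isSubLmodule of dual by <:].

Definition dual_norm_le (y : dual) (c : K) : Prop :=
  op_norm_le (@sup_norm_le K Omega) (@abs_le K) y c.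

Definition End_X (U : X -> X) : Prop :=
  bounded_linear (@sup_norm_le K Omega) (@sup_norm_le K Omega) U.

Definition End_dual (T : dual -> dual) : Prop :=
  bounded_linear dual_norm_le dual_norm_le T.

Lemma adjoint_subproof (U : X -> X) (hU : End_X U) (y : dual) :
  (fun x => y (U x)) \in dual_pred.
Proof.
case: hU => Ul [c [c0 Uc]]; have /asboolP [yl [d [d0 yd]]] := dualP y.
apply/asboolP; split=> [a u v|]; first by rewrite Ul yl.
exists (d * c); split=> [|x b xb]; first exact: mulr_ge0.
by rewrite -mulrA; apply/yd/Uc.
Qed.

Definition adjoint (U : X -> X) (hU : End_X U) (y : dual) : dual :=
  Dual (adjoint_subproof hU y).

(* W*O-convergence along a filter F on the index set of a family of operators;
   F is \oo for a sequence. *)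
Definition WO_cvg (I : Type) (F : set_system I) (T : I -> dual -> dual)
    (L : dual -> dual) : Prop :=
  forall (x : X) (y : dual), (fun i => T i y x) @ F --> (L y x : K^o).

End dual.

Section semicascade.
Context (K : numFieldType) (Omega : topologicalType).
Context (phi : Omega -> Omega) (hphi : continuous phi).
Local Notation X := (contfun K Omega).

Lemma koopman_subproof (x : X) :
  (fun w => x (phi w)) \in @continuous_pred K Omega.
Proof.
apply/asboolP => w; have /asboolP xc := contfunP x.
by apply: continuous_comp; [exact: hphi|exact: xc].
Qed.

Definition koopman (x : X) : X := Contfun (koopman_subproof x).

Lemma koopman_End : End_X koopman.
Proof.
split=> [a u v|]; first exact: val_inj.
exists 1; split=> // x b [b0 xb]; rewrite mul1r; split=> // w; exact: xb.
Qed.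

Definition koopman_adjoint : dual K Omega -> dual K Omega :=
  adjoint koopman_End.

End semicascade.

Definition convex_hull (K : numFieldType) (E : lmodType K) (S : set E) : set E :=
  [set T | exists (n : nat) (c : 'I_n -> K) (v : 'I_n -> E),
    [/\ forall i, 0 <= c i, \sum_i c i = 1, forall i, S (v i)
      & T = \sum_i c i *: v i]].

Section ergodic_nets.
Context (K : numFieldType) (Omega : topologicalType).
Context (phi : Omega -> Omega) (hphi : continuous phi).
Local Notation V := (@koopman_adjoint K Omega phi hphi).

(* The hull is taken in the space of all maps from the dual to itself, of which
   the bounded linear ones form a linear subspace. *)
Definition G0 : set (dual K Omega -> dual K Omega) :=
  convex_hull (range (fun n : nat => iter n V)).

Definition ergodic (I : Type) (F : set_system I)
    (T : I -> dual K Omega -> dual K Omega) : Prop :=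
  WO_cvg F (fun i => T i \o (id - V)) 0.

End ergodic_nets.

Section nets.
Context (A : Type) (le : A -> A -> Prop).

Definition directed : Prop :=
  [/\ inhabited A, forall a, le a a,
      forall a b c, le a b -> le b c -> le a c
    & forall a b, exists c, le a c /\ le b c].

(* Convergence of a net is convergence along this filter. *)
Definition tails : set_system A :=
  filter_from [set: A] (fun a => [set b | le a b]).

(* The indices of a subsequence of a net increase strictly, except that an
   index may be repeated once it is a greatest element of A. For A = nat these
   are exactly the index sequences of subsequences in the usual sense. *)
Definition subsequence_indices (alpha : nat -> A) : Prop :=
  forall k, le (alpha k) (alpha k.+1) /\
    ((exists b, ~ le b (alpha k)) -> ~ le (alpha k.+1) (alpha k)).

End nets.

(* Main.v *)
(* If E = E(Omega, phi) is metrizable, then for x in C(Omega) and y in its dual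
   the sequence n |-> y (x o phi^n) is uniformly continuous for the metric that
   n |-> phi^n pulls back from E: when phi^n and phi^m are close in E, the
   functions x o phi^n - x o phi^m are bounded and pointwise small, and bounded
   pointwise convergence implies weak convergence in C(Omega). Since E is
   compact, the integers split, for every j, into finitely many cells of
   diameter 1/j, so that the value (T x, y) of a convex combination T of the V^n
   is determined up to a uniform error by the weights that T gives to these
   cells. The countably many cell weights of T_alpha have a cluster point in a
   product of copies of [0, 1], which is reached along a subsequence of indices;
   along it every (T x, y) converges. When y is in the range of I - V, the limit
   is 0, because the whole net tends to 0. *)
Require Import Defs.
From HB Require Import structures.
From mathcomp Require Import all_boot all_order all_algebra.
From mathcomp Require Import all_classical all_reals all_analysis.
From mathcomp Require complex.
From mathcomp Require Import ring lra.

Set Implicit Arguments.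
Unset Strict Implicit.
Unset Printing Implicit Defensive.

Import Order.TTheory GRing.Theory Num.Theory.
Import numFieldNormedType.Exports.

Local Open Scope classical_set_scope.
Local Open Scope ring_scope.

(** * Bounded convergence for functionals on C(Omega) *)

Section bounded_convergence.
Context (R : realType) (Omega : topologicalType).
Hypothesis Omega_compact : compact [set: Omega].
Local Notation X := (contfun R Omega).

Lemma contfun_continuous (K : numFieldType) (x : contfun K Omega) :
  continuous (x : Omega -> K^o).
Proof. by have /asboolP := contfunP x. Qed.

(** Dini's argument: an index that works at a point works near it by continuity, and later ones do
    by monotonicity; compactness makes the index uniform. *)
Lemma dini (u : nat -> X) (e : R) : 0 < e ->
  (forall n w, `|u n.+1 w| <= `|u n w|) ->
  (forall w, exists n, `|u n w| < e) ->
  \forall n \near \oo, forall w, `|u n w| < e.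
Proof.
move=> e0 udec u0.
have umono w m n : (m <= n)%N -> `|u n w| <= `|u m w|.
  move=> /subnK <-; elim: (n - m)%N => // k; rewrite addSn.
  exact/le_trans/udec.
have /compact_near_coveringP cov := Omega_compact.
have := cov nat \oo (fun n w => `|u n w| < e) _.
case=> [w _|N _ HN]; last by exists N => // n /HN uw w; exact: uw.
have [n un] := u0 w; near=> w' m => /=.
apply: (@le_lt_trans _ _ `|u n w'|); first exact: umono (near (nbhs_infty_ge n) m _).
near: w'.
have : `|u n w'| @[w' --> w] --> `|u n w|.
  by apply: cvg_norm; exact: contfun_continuous.
by move=> /cvgr_lt; exact.
Unshelve. all: by end_near. Qed.

Lemma clip_subproof (h u : X) :
  (fun w => Num.max (- `|u w|) (Num.min (h w) `|u w|))
    \in @continuous_pred R Omega.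
Proof.
apply/asboolP => w.
have nc : {for w, continuous (fun w => `|u w| : R^o)}.
  by apply: cvg_norm; exact: contfun_continuous.
apply: (@continuous_max _ _ (fun w => - `|u w|)); first exact: cvgN.
by apply: (@continuous_min _ _ _ (fun w => `|u w|)); first exact: contfun_continuous.
Qed.

Definition clip (h u : X) : X := Contfun (clip_subproof h u).

(** Where [|h| <= |u|] the truncation is [h] itself; elsewhere it is [|u|] with the sign of [h], and
    the excess [h - clip h u] has modulus [|h| - |u|]. *)
Lemma clip_bounds (h u : X) w :
  [/\ `|clip h u w| <= `|u w|, `|clip h u w| <= `|h w|
    & `|u w + (h w - clip h u w)| <= `|u w| \/
      `|u w + (h w - clip h u w)| <= `|h w| ].
Proof.
rewrite /clip /=; move: (u w) (h w) => a b.
have [ba|ab] := lerP `|b| `|a|.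
  have := ba; rewrite ler_norml => /andP[? ?].
  rewrite min_l// max_r// subrr addr0.
  by split=> //; left.
have a0 : 0 <= `|a| by [].
suff [m [-> ma mb mab]] : exists m,
    [/\ Num.max (- `|a|) (Num.min b `|a|) = m, `|m| <= `|a|, `|m| <= `|b|
      & `|a + (b - m)| <= `|b| ] by split=> //; right.
have [b0|b0] := lerP 0 b.
  exists `|a|; rewrite (ger0_norm b0) in ab *.
  rewrite min_r ?max_r ?normr_id ?(ltW ab)//; last by lra.
  split=> //; have := ler_norm a; have := ler_norm (- a).
  by rewrite normrN ler_norml; lra.
exists (- `|a|); rewrite (ltr0_norm b0) in ab *.
rewrite min_l ?max_l ?normrN ?normr_id ?(ltW ab)//; try lra.
split=> //; have := ler_norm a; have := ler_norm (- a).
by rewrite normrN ler_norml; lra.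
Qed.

Context (Z : X -> R) (c b : R) (f : nat -> X).
Hypothesis ZB : forall x y, Z (x - y) = Z x - Z y.
Hypothesis Zc : forall x d, sup_norm_le x d -> `|Z x| <= c * d.
Hypothesis fb : forall n w, `|f n w| <= b.
Hypothesis f0 : forall w, (f n w : R) @[n --> \oo] --> (0 : R).

Let Z0 : Z 0 = 0. Proof. by have := ZB 0 0; rewrite subrr => ->; rewrite subrr. Qed.
Let ZN x : Z (- x) = - Z x. Proof. by rewrite -[- x]sub0r ZB Z0 sub0r. Qed.
Let ZD x y : Z (x + y) = Z x + Z y. Proof. by rewrite -[y in LHS]opprK ZB ZN opprK. Qed.

(* The continuous functions below [sup_(k >= n) |f k|]. *)
Let H n : set X := [set h | forall w, exists2 k, (n <= k)%N & `|h w| <= `|f k w| ].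
Let J n := sup [set Z h | h in H n].

Let Hsup n : has_sup [set Z h | h in H n].
Proof.
split; first by exists (Z (f n)), (f n) => // w; exists n.
exists (c * `|b|) => _ [h Hh <-]; apply: (le_trans (ler_norm _)); apply: Zc.
split=> // w; have [k _ /le_trans ->//] := Hh w.
by apply: (le_trans (fb k w)); rewrite ler_norm.
Qed.

Let leJ n h : H n h -> Z h <= J n.
Proof. by move=> Hh; apply: (ub_le_sup (Hsup n).2); exists h. Qed.

Let adhJ n (e : R) : 0 < e -> exists2 h, H n h & J n - e < Z h.
Proof. by move=> /sup_adherent/(_ (Hsup n)) [_ [h Hh <-] ?]; exists h. Qed.

(** With [g] an almost maximizer at level [n.+1], take [h' = clip g h]. As [h + (g - h')] stays in
    [H n], [Z h + Z g - Z h' <= J n], so the defects [d] and [e] merely add up. *)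
Let step n h (d e : R) : 0 < e -> H n h -> J n - d <= Z h ->
  exists h', [/\ H n.+1 h', J n.+1 - (d + e) <= Z h'
               & forall w, `|h' w| <= `|h w| ].
Proof.
move=> e0 Hh Jh; have [g Hg Jg] := adhJ n.+1 e0; exists (clip g h).
have gP := clip_bounds g h.
split; last by move=> w; have [] := gP w.
  by move=> w; have [k nk gk] := Hg w; exists k => //; have [_ /le_trans ->] := gP w.
have : Z (h + (g - clip g h)) <= J n.
  apply: leJ => w; have [_ _ [hw|hw]] := gP w.
    by have [k nk hk] := Hh w; exists k => //; exact: le_trans hk.
  by have [k nk hk] := Hg w; exists k; [exact: ltnW|exact: le_trans hk].
rewrite ZD ZB; lra.
Qed.

(* Luxemburg's proof of Arzela's theorem: almost maximizers of [Z] on [H n]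
   may be chosen with decreasing moduli, and these tend to 0 uniformly. *)
Lemma bounded_convergence : Z (f n) @[n --> \oo] --> (0 : R).
Proof.
apply/cvgrPdist_lt => e e0; pose t n : R := e / 2 / 2 ^+ n.+1.
have t0 n : 0 < t n by rewrite !divr_gt0 ?exprn_gt0.
have tS n : t n = t n.+1 + t n.+1 by rewrite /t (exprS _ n.+1); field; rewrite expf_neq0.
(* The defects start at [d 0 = e / 4], grow by [t n.+1] at step [n], and never reach [e / 2]. *)
pose d n : R := e / 2 - t n; have dE n : d n + t n = e / 2 by rewrite /d; lra.
have [h0 Hh0 Jh0] := @adhJ 0%N (d 0%N) ltac:(by rewrite /d /t expr1; lra).
pose P n h := H n h /\ J n - d n <= Z h.
(* A total [next] allows plain recursion; 0 is a dummy value where [P] fails. *)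
have /choice[next nextP] (nh : nat * X) : exists h', P nh.1 nh.2 ->
    P nh.1.+1 h' /\ forall w, `|h' w| <= `|nh.2 w|.
  case: nh => n h /=; have [[Hh Jh]|nP] := pselect (P n h); last by exists 0.
  have [|h' [H1 H2 H3]] := @step n h (d n) (d n.+1 - d n) _ Hh Jh.
    by have := tS n; have := t0 n.+1; rewrite /d; lra.
  exists h' => _; split=> //; split=> //.
  by move: H2; rewrite [d n + _]addrC subrK.
pose u := fix u n := if n is m.+1 then next (m, u m) else h0.
have Pu n : P n (u n).
  elim: n => [|n /(nextP (n, _))[]//]; split=> //; exact: ltW.
have udec n w : `|u n.+1 w| <= `|u n w| by have [_] := nextP (n, u n) (Pu n).
pose eta := e / 2 / (`|c| + 1).
have c1 : 0 < `|c| + 1 by rewrite ltr_wpDl.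
have eta0 : 0 < eta by rewrite !divr_gt0.
(* Since [u N] lies in [H N], at each point it is dominated by some late [f k], which is small
   there. *)
have := dini eta0 udec; case=> [w|N _ HN].
  have /cvgrPdist_lt/(_ _ eta0)[N _ HN] := f0 w.
  exists N; have [/(_ w)[k Nk uk] _] := Pu N.
  by apply: (le_lt_trans uk); have := HN k Nk; rewrite /= sub0r normrN.
exists N => // n /= Nn; rewrite sub0r normrN.
have JZ : J n <= d n + c * eta.
  rewrite -lerBlDl; apply: (le_trans (Pu n).2); apply: (le_trans (ler_norm _)).
  by apply: Zc; split=> [|w]; [exact: ltW|exact/ltW/HN].
have fJ : `|Z (f n)| <= J n.
  rewrite ler_norml lerNl -ZN !leJ// => w; exists n => //.
  by rewrite normrN.
apply: (le_lt_trans fJ); apply: (le_lt_trans JZ).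
have ce : c * eta <= e / 2.
  rewrite /eta mulrA ler_pdivrMr// mulrC ler_wpM2l//; first by lra.
  by rewrite (le_trans (ler_norm _))// lerDl.
by have := dE n; have := t0 n; lra.
Qed.

End bounded_convergence.

(** * Real and complex scalars *)

Section scalar_parts.
Import complex.
Context (R : realType) (s : scalar_kind).
Local Notation K := (scalars R s).

(* Coordinates treating both scalar fields alike: z = embed (part false z) +
   imag * embed (part true z), where imag and part true are 0 for real scalars. *)
Definition embed : R -> K :=
  match s return R -> scalars R s with
  | RealScalars => id
  | ComplexScalars => fun r => (r%:C)%C
  end.

Definition part (i : bool) : K -> R :=
  match s return scalars R s -> R with
  | RealScalars => fun z => if i then 0 else z
  | ComplexScalars => fun z => if i then complex.Im z else complex.Re z
  end.

Definition imag : K :=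
  match s return scalars R s with
  | RealScalars => 0
  | ComplexScalars => ('i)%C
  end.

Lemma embedB : {morph embed : a b / a - b}.
Proof. by rewrite /embed; case: (s) => a b //; rewrite rmorphB. Qed.

Lemma embed_norm r : `|embed r| = embed `|r|.
Proof.
rewrite /embed; case: (s) => //.
by rewrite normc_def /= expr0n /= addr0 sqrtr_sqr.
Qed.

Lemma ler_embed : {mono embed : a b / a <= b}.
Proof. by rewrite /embed; case: (s) => a b //; rewrite lecR. Qed.

Lemma ltr_embed : {mono embed : a b / a < b}.
Proof. exact: leW_mono ler_embed. Qed.

Lemma embed0 : embed 0 = 0.
Proof. by rewrite -(subrr 0) embedB subrr. Qed.

Lemma embedM : {morph embed : a b / a * b}.
Proof. by rewrite /embed; case: (s) => a b //; rewrite rmorphM. Qed.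

Lemma embedN : {morph embed : a / - a}.
Proof. by move=> a; rewrite -sub0r embedB embed0 sub0r. Qed.

Lemma embedD : {morph embed : a b / a + b}.
Proof. by move=> a b; rewrite -[b in LHS]opprK embedB embedN opprK. Qed.

Lemma embed1 : embed 1 = 1.
Proof. by rewrite /embed; case: (s). Qed.

(** A nonnegative complex number is real, so norms, tolerances and convex coefficients in [K] all
    come from [R]. *)
Lemma embed_part (z : K) : 0 <= z -> z = embed (part false z).
Proof.
rewrite /embed /part; case: (s) z => // z z0.
by rewrite RRe_real// ger0_real.
Qed.

Lemma partB i : {morph part i : y z / y - z}.
Proof.
move=> y z; rewrite /part; case: (s) y z => y z; first by case: i => //; rewrite subrr.
by case: i; case: y z => [? ?] [? ?].
Qed.

Lemma part0 i : part i 0 = 0.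
Proof. by rewrite -(subrr 0) partB subrr. Qed.

Lemma partD i : {morph part i : y z / y + z}.
Proof.
by move=> y z; rewrite -[z in LHS]opprK partB -[- z]sub0r partB part0 sub0r opprK.
Qed.

Lemma part1 : part false 1 = 1.
Proof. by rewrite /part; case: (s). Qed.

Lemma part_embedM i r (z : K) : part i (embed r * z) = r * part i z.
Proof.
rewrite /part /embed; case: (s) z => z; first by case: i => //; rewrite mulr0.
by case: i; case: z => a b /=; rewrite mul0r ?addr0 ?subr0.
Qed.

Lemma part_norm_le i (z : K) : embed `|part i z| <= `|z|.
Proof.
rewrite /part /embed; case: (s) z => z; first by case: i => //; rewrite normr0.
rewrite normc_def lecR -sqrtr_sqr ler_wsqrtr//.
by case: i; rewrite ?lerDl ?lerDr sqr_ge0.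
Qed.

Lemma part_decomp (z : K) : z = embed (part false z) + imag * embed (part true z).
Proof.
rewrite /part /embed /imag; case: (s) z => z; first by rewrite mul0r addr0.
exact: complexE.
Qed.

Lemma embed_cvg (T : Type) (F : set_system T) {FF : Filter F} (u : T -> R) (l : R) :
  u t @[t --> F] --> l -> (embed (u t) : K^o) @[t --> F] --> (embed l : K^o).
Proof.
move=> /cvgrPdist_lt ul; apply/cvgrPdist_lt => e e0.
have eE := embed_part (ltW e0).
have {}ul := ul (part false e) ltac:(by rewrite -ltr_embed embed0 -eE).
apply: filterS ul => t; rewrite -ltr_embed -eE.
by rewrite -embedB embed_norm.
Qed.

Lemma parts_cvg (T : Type) (F : set_system T) {FF : Filter F} (u : T -> K) (l : bool -> R) :
  (forall i, part i (u t) @[t --> F] --> l i) ->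
  (u t : K^o) @[t --> F] --> (embed (l false) + imag * embed (l true) : K^o).
Proof.
move=> ul; under eq_fun do rewrite (part_decomp (u _)).
by apply: cvgD; [|apply: cvgZr]; exact: embed_cvg.
Qed.

Lemma part_cvg (T : Type) (F : set_system T) {FF : Filter F} (u : T -> K) (l : K) i :
  (u t : K^o) @[t --> F] --> (l : K^o) -> part i (u t) @[t --> F] --> part i l.
Proof.
move=> /cvgrPdist_lt ul; apply/cvgrPdist_lt => e e0.
have {}ul := ul (embed e) ltac:(by rewrite -embed0 ltr_embed).
apply: filterS ul => t; rewrite -ltr_embed; apply: le_lt_trans.
by rewrite -partB; exact: part_norm_le.
Qed.

End scalar_parts.

Arguments embed {R s}.
Arguments imag {R s}.

Section dual_elements.
Context (K : numFieldType) (Omega : topologicalType).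
Local Notation X := (contfun K Omega).

Lemma dual_linear (y : dual K Omega) : linear (y : X -> K^o).
Proof. by have /asboolP[] := dualP y. Qed.

Lemma dualB (y : dual K Omega) : {morph (y : X -> K^o) : u v / u - v}.
Proof.
by move=> u v; rewrite -scaleN1r addrC dual_linear scaleN1r addrC.
Qed.

Lemma dualZ (y : dual K Omega) a (u : X) : y (a *: u) = a * y u.
Proof. by rewrite -[a *: u]addr0 dual_linear -(subrr 0) dualB subrr addr0. Qed.

End dual_elements.

(** * Bounded convergence over either scalar field *)

Section dual_convergence.
Context (R : realType) (s : scalar_kind) (Omega : topologicalType).
Local Notation K := (scalars R s).
Hypothesis Omega_compact : compact [set: Omega].
Local Notation X := (contfun K Omega).

Lemma contfun_bounded (x : X) : exists b : R, forall w, `|x w| <= embed b.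
Proof.
pose g w := part false `|x w|.
have gE w : `|x w| = embed (g w) by rewrite /g -embed_part.
have gc w : g w' @[w' --> w] --> g w.
  by apply: part_cvg; apply: cvg_norm; exact: contfun_continuous.
have /compact_near_coveringP cov := Omega_compact.
case: (cov nat \oo (fun n w => g w < n%:R) _ _) => [w _|N _ /(_ N (leqnn N)) HN].
  near=> w' n => /=; apply: (@lt_le_trans _ _ (g w + 1)).
    near: w'; have /cvgr_lt := gc w; apply; by rewrite ltrDl.
  by near: n; exact: nbhs_infty_ger.
by exists N%:R => w; rewrite gE ler_embed ltW//; exact: HN.
Unshelve. all: by end_near. Qed.

Lemma dual_bounded (y : dual K Omega) : exists c : R, 0 <= c /\
  forall (x : X) b, (forall w, `|x w| <= embed b) -> 0 <= b -> `|y x| <= embed (c * b).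
Proof.
have /asboolP[_ [c [c0 yc]]] := dualP y.
have cE := embed_part c0; exists (part false c); split.
  by rewrite -(@ler_embed R s) -cE embed0.
move=> x b xb b0; rewrite embedM -cE; apply: yc; split=> //.
by rewrite -(@embed0 R s) ler_embed.
Qed.

Lemma embed_contfun_subproof (g : contfun R Omega) :
  (fun w => embed (g w)) \in @continuous_pred K Omega.
Proof. by apply/asboolP => w; apply: embed_cvg; exact: contfun_continuous. Qed.

Definition embed_contfun (g : contfun R Omega) : X :=
  Contfun (embed_contfun_subproof g).

Lemma part_contfun_subproof i (x : X) :
  (fun w => part i (x w) : R^o) \in @continuous_pred R Omega.
Proof. by apply/asboolP => w; apply: part_cvg; exact: contfun_continuous. Qed.

Definition part_contfun i (x : X) : contfun R Omega :=
  Contfun (part_contfun_subproof i x).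

(** Splitting [f n] into its two parts reduces the claim to the functionals [Z j] on real functions,
    which are additive and bounded with real values. *)
Lemma dual_bounded_convergence (y : dual K Omega) (f : nat -> X) (b : R) i :
  (forall n w, `|f n w| <= embed b) ->
  (forall w, (f n w : K^o) @[n --> \oo] --> (0 : K^o)) ->
  part i (y (f n)) @[n --> \oo] --> (0 : R).
Proof.
move=> fb f0; pose a (j : bool) : K := if j then imag else 1.
pose Z j g := part i (y (a j *: embed_contfun g)).
have ZB j g h : Z j (g - h) = Z j g - Z j h.
  rewrite /Z -partB -dualB -scalerBr; congr (part _ (y (_ *: _))).
  by apply: val_inj; apply/funext => w /=; exact: embedB.
have ZE n : part i (y (f n)) = Z false (part_contfun false (f n)) -
    Z true (- part_contfun true (f n)).
  rewrite /Z -partB -dualB scale1r; congr (part _ (y _)).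
  apply: val_inj; apply/funext => w /=; rewrite {1}[f n w]part_decomp.
  congr (_ + _); 
  rewrite -[RHS]/(- (imag * embed (- part true (f n w)))).
  by rewrite embedN mulrN opprK.
have [c [c0 yc]] := dual_bounded y.
have Zc j g d : sup_norm_le g d -> `|Z j g| <= part false `|a j| * c * d.
  move=> [d0 gd]; rewrite -(@ler_embed R s); apply: (le_trans (part_norm_le _ _)).
  rewrite dualZ normrM -mulrA embedM -embed_part// ler_wpM2l//; apply: yc => // w.
  by rewrite embed_norm ler_embed.
have pfb j n w : `|part j (f n w)| <= b.
  by rewrite -(@ler_embed R s); exact: le_trans (part_norm_le _ _) (fb n w).
have pf0 j w : part j (f n w) @[n --> \oo] --> (0 : R).
  by rewrite -(@part0 R s j); apply: part_cvg; exact: f0.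
under eq_fun do rewrite ZE.
rewrite -(subrr (0 : R)).
apply: cvgB; first exact: (bounded_convergence
    (f := fun n => part_contfun false (f n)) Omega_compact (ZB _) (Zc _)
    (pfb _) (pf0 _)).
apply: (bounded_convergence
  (f := fun n => - part_contfun true (f n)) Omega_compact (ZB _) (Zc _)
  (b := b)) => // [n w|w].
  by have := pfb true n w; rewrite -normrN.
by rewrite -(@oppr0 R); apply: cvgN; exact: pf0.
Qed.

End dual_convergence.

(** * The enveloping semigroup *)

Section compact_pseudometric.
Context (R : realType) (M : pseudoMetricType R).
Hypothesis M_compact : compact [set: M].

Lemma compact_continuous_unif (K : numFieldType) (g : M -> K^o) (eps : K) :
  continuous g -> 0 < eps ->
  exists2 d : R, 0 < d & forall a b, ball a d b -> `|g a - g b| < eps.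
Proof.
move=> gc e0; have /compact_near_coveringP cov := M_compact.
have := cov R (0 : R)^'+ (fun d a => forall b, ball a d b -> `|g a - g b| < eps) _.
case=> [a0 _|d /= d0 Hd].
  have /cvgrPdist_lt/(_ (eps / 2)) := gc a0.
  rewrite divr_gt0// => /(_ isT)/nbhs_ballP[r /= r0 Hr].
  near=> a d => b ab.
  have a0a : ball a0 (r / 2) a.
    by near: a; apply: nbhsx_ballx; rewrite divr_gt0.
  have dr : d < r / 2 by near: d; apply: nbhs_right_lt; rewrite divr_gt0.
  have a0b : ball a0 r b.
    by rewrite [r]splitr; apply: ball_triangle a0a _; apply: le_ball ab; exact: ltW.
  have {}a0a : ball a0 r a by apply: le_ball a0a; lra.
  rewrite -(subrKA (g a0)) [eps]splitr (le_lt_trans (ler_normD _ _))//.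
  by rewrite ltrD// ?[`|g a - _|]distrC Hr.
have d20 : 0 < d / 2 by rewrite divr_gt0.
exists (d / 2) => // a b; apply: Hd => //=.
by rewrite sub0r normrN gtr0_norm//; lra.
Unshelve. all: by end_near. Qed.

(** The centres are terms of the sequence, so that cells are labelled by integers. Near a point [m],
    either one term within [d / 2] of [m] serves all terms nearby, or there are no terms nearby. *)
Lemma compact_totally_bounded_seq (e : nat -> M) (d : R) : 0 < d ->
  exists N, forall n, exists2 n', (n' < N)%N & ball (e n) d (e n').
Proof.
move=> d0; have /compact_near_coveringP cov := M_compact.
pose P N m := forall n, ball m (d / 4) (e n) ->
  exists2 n', (n' < N)%N & ball (e n) d (e n').
have d4 : 0 < d / 4 by lra.
have [m _|N _ /(_ N (leqnn N)) HN] := cov nat \oo P _.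
  have [[k mk]|no] := pselect (exists k, ball m (d / 2) (e k)).
    near=> m' N; have kN : (k < N)%N by near: N; exact: nbhs_infty_gt.
    move=> n m'n; exists k => //.
    have mm' : ball m (d / 4) m' by near: m'; exact: nbhsx_ballx.
    have := ball_triangle (ball_triangle (ball_sym m'n) (ball_sym mm')) mk.
    by apply: le_ball; lra.
  near=> m' N => n m'n; case: no; exists n.
  have mm' : ball m (d / 4) m' by near: m'; exact: nbhsx_ballx.
  by have := ball_triangle mm' m'n; apply: le_ball; lra.
exists N => n; have := HN (e n) I n; apply; exact: ballxx.
Unshelve. all: by end_near. Qed.

End compact_pseudometric.

(** * Orbits and the enveloping semigroup *)

Section semicascade.
Context (R : realType) (s : scalar_kind) (Omega : topologicalType).
Local Notation K := (scalars R s).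
Hypothesis Omega_compact : compact [set: Omega].
Context (phi : Omega -> Omega) (hphi : continuous phi).
Local Notation X := (contfun K Omega).
Local Notation U := (koopman hphi : X -> X).
Local Notation V := (@koopman_adjoint K Omega phi hphi).

Lemma iter_koopman n (x : X) w : iter n U x w = x (iter n phi w).
Proof. by elim: n w => //= n IHn w; rewrite IHn -iterSr. Qed.

Lemma iter_koopman_adjoint n y (x : X) : iter n V y x = y (iter n U x).
Proof. by elim: n x => //= n IHn x; rewrite IHn -iterSr. Qed.

(** A cluster point in [E] of the filter pushed forward to [T] is a cluster point of the original
    one, because open sets of the subtype are traces of open sets. *)
Lemma set_type_compact (T : topologicalType) (E : set T) :
  compact E -> compact [set: E].
Proof.
move=> Ecompact F FF _.
pose G := (set_val : E -> T) @ F.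
have GE : G E by apply: (@filterE _ F) => p; exact: set_valP.
have [p [Ep Gp]] := Ecompact G _ GE.
exists (exist _ p (mem_set Ep)); split=> // A B FA.
rewrite nbhsE => -[_ [[C oC <-] Cp] CB].
have GA : G (set_val @` A) by apply: (@filterS _ F _ A) => // a Aa; exists a.
have pC : nbhs p C by apply: open_nbhs_nbhs.
have [_ [[a Aa <-] Ca]] := Gp _ _ GA pC.
by exists a; split=> //; exact: CB.
Qed.

(** [M] is a metric copy of the enveloping semigroup, [e n] the point for [phi^n], [ev w] evaluation
    at [w]. Compactness holds by Tychonoff's theorem, the semigroup being closed in the product. *)
Lemma ordinary_compact_model : ordinary phi R ->
  exists (M : pseudoMetricType R) (e : nat -> M) (ev : Omega -> M -> Omega),
    [/\ compact [set: M], forall w, continuous (ev w)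
      & forall n w, ev w (e n) = iter n phi w].
Proof.
move=> [M [f [g [fc gc fK gK]]]].
have EV n : enveloping_semigroup phi (iter n phi : {ptws Omega -> Omega}).
  by apply: subset_closure; exists n.
exists M, (fun n => f (exist _ (iter n phi : {ptws Omega -> Omega}) (mem_set (EV n)))),
  (fun w m => set_val (g m) w).
split=> [|w|n w]; last by rewrite fK.
  have Ec : compact (enveloping_semigroup phi).
    have := @tychonoff Omega (fun=> Omega) (fun=> setT) (fun=> Omega_compact).
    by move=> /(subclosed_compact (@closed_closure _ _)); apply.
  have /continuous_compact := set_type_compact Ec.
  have fs : f @` setT = setT.
    by apply/seteqP; split=> // m _; exists (g m).
  by rewrite -fs; apply; exact: continuous_subspaceT.
move=> m; apply: (@continuous_comp _ _ _ (fun m => set_val (g m)) (proj w)).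
  apply: continuous_comp; [exact: gc|exact: initial_continuous].
exact: proj_continuous.
Qed.

Section dominated.
Context (M : pseudoMetricType R) (e : nat -> M) (ev : Omega -> M -> Omega).
Hypotheses (M_compact : compact [set: M]) (ev_continuous : forall w, continuous (ev w)).
Hypothesis ev_e : forall n w, ev w (e n) = iter n phi w.

(** Otherwise some pairs [e n], [e m] are arbitrarily close with values [eps] apart. The differences
    of the iterates of [x] are then bounded and tend to 0 pointwise, against bounded convergence. *)
Lemma orbit_unif_continuous (y : dual K Omega) (x : X) i (eps : R) : 0 < eps ->
  exists2 d : R, 0 < d & forall n m, ball (e n) d (e m) ->
    `|part i (y (iter n U x)) - part i (y (iter m U x))| < eps.
Proof.
move=> eps0; apply: contrapT => no.
have /choice[nm nmP] (k : nat) : exists nm : nat * nat,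
    ball (e nm.1) k.+1%:R^-1 (e nm.2) /\
    eps <= `|part i (y (iter nm.1 U x)) - part i (y (iter nm.2 U x))|.
  apply: contrapT => nok; apply: no; exists k.+1%:R^-1; first by rewrite invr_gt0.
  move=> n m nmk; rewrite ltNge; apply/negP => le_eps.
  by apply: nok; exists (n, m).
have [b xb] := contfun_bounded Omega_compact x.
pose f k := iter (nm k).1 U x - iter (nm k).2 U x.
have fE k w : f k w = x (ev w (e (nm k).1)) - x (ev w (e (nm k).2)).
  by rewrite !ev_e -!iter_koopman.
have fb k w : `|f k w| <= embed (b + b).
  by rewrite fE embedD (le_trans (ler_normB _ _))// lerD.
have f0 w : (f k w : K^o) @[k --> \oo] --> (0 : K^o).
  apply/cvgrPdist_lt => eta eta0.
  have gc : continuous (fun m => x (ev w m) : K^o).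
    by move=> m; apply: continuous_comp; [exact: ev_continuous|exact: contfun_continuous].
  have [d d0 gd] := compact_continuous_unif M_compact gc eta0.
  near=> k; rewrite sub0r normrN fE; apply: gd.
  have [+ _] := nmP k; apply: le_ball; apply: ltW.
  near: k; exact: near_infty_natSinv_lt (PosNum d0).
have := dual_bounded_convergence Omega_compact y i fb f0.
move=> /cvgrPdist_lt/(_ _ eps0)[N _ /(_ N (leqnn N))] /=.
rewrite sub0r normrN dualB partB; have [_ +] := nmP N.
by move=> /le_lt_trans h /h; rewrite ltxx.
Unshelve. all: by end_near. Qed.

End dominated.
End semicascade.

(** * Means over convex weights *)

Section means.
Context (R : realType).

(* The list of pairs (c, n) encodes the convex combination of the V^n with
   coefficients c. *)
Definition mean (l : seq (R * nat)) (G : nat -> R) : R :=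
  \sum_(q <- l) q.1 * G q.2.

Definition convex_weights (l : seq (R * nat)) : Prop :=
  (forall q, q \in l -> 0 <= q.1) /\ \sum_(q <- l) q.1 = 1.

Lemma mean_dist l G H (eps : R) : convex_weights l ->
  (forall n, `|G n - H n| <= eps) -> `|mean l G - mean l H| <= eps.
Proof.
move=> [l0 l1] GH; rewrite /mean -sumrB (le_trans (ler_norm_sum _ _ _))//.
rewrite -[leRHS]mul1r -l1 mulr_suml big_seq [leRHS]big_seq; apply: ler_sum => q ql.
by rewrite -mulrBr normrM ger0_norm ?l0// ler_wpM2l// l0.
Qed.

Lemma mean_indic_itv l (P : nat -> bool) : convex_weights l ->
  0 <= mean l (fun n => (P n)%:R) <= 1.
Proof.
move=> [l0 l1]; rewrite /mean; apply/andP; split.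
  by rewrite big_seq; apply: sumr_ge0 => q ql; rewrite mulr_ge0// l0.
rewrite -[leRHS]l1 big_seq [leRHS]big_seq; apply: ler_sum => q ql.
by case: (P _); rewrite ?mulr1// mulr0 l0.
Qed.

Lemma mean_cells l (c : nat -> nat) N G : (forall n, (c n < N)%N) ->
  mean l (fun n => G (c n)) =
  \sum_(i < N) G i * mean l (fun n => (c n == i)%:R).
Proof.
move=> cN; rewrite /mean.
under [RHS]eq_bigr do rewrite mulr_sumr.
rewrite exchange_big; apply: eq_bigr => q _ /=.
rewrite (bigD1 (Ordinal (cN q.2)))//= eqxx mulr1 [G _ * _]mulrC big1 ?addr0// => i ne.
rewrite [_ == _]negbTE ?mulr0//; apply: contraNneq ne => eqi.
by apply/eqP/val_inj.
Qed.

End means.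

Lemma tails_filter (A : Type) (le : A -> A -> Prop) :
  directed le -> ProperFilter (tails le).
Proof.
move=> [[a0] refl trans dir]; apply: filter_from_proper; last by move=> a _; exists a.
apply: filter_from_filter; first by exists a0.
move=> a b _ _; have [c [ac bc]] := dir a b; exists c => // d cd.
by split; apply: trans cd.
Qed.

(** * Selection of the subsequence *)

Section selection.
Context (R : realType) (A : Type) (le : A -> A -> Prop).
Hypothesis dir : directed le.

Lemma frequent_subsequence (P : nat -> set A) :
  (forall k a, exists2 b, le a b & P k b) ->
  exists alpha : nat -> A, subsequence_indices le alpha /\ forall k, P k (alpha k).
Proof.
have [[a0] refl trans up] := dir.
move=> freq; have /choice[pick pickP] (ka : nat * A) : exists b, le ka.2 b /\ P ka.1 b.
  by have [b ? ?] := freq ka.1 ka.2; exists b.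
(* An upper bound of [a] and of some [b] not below [a] is itself not below [a]; without such a [b],
   [a] is greatest and may be repeated. *)
have /choice[bump bumpP] a : exists b, le a b /\ ((exists b, ~ le b a) -> ~ le b a).
  have [[b ba]|no] := pselect (exists b, ~ le b a); last by exists a.
  have [c [ac bc]] := up a b; exists c; split=> // _ ca; exact/ba/(trans _ _ _ bc).
pose alpha := fix alpha k :=
  if k is k'.+1 then pick (k, bump (alpha k')) else pick (0%N, a0).
exists alpha; split; last first.
  by case=> [|k]; [exact: (pickP (0%N, a0)).2|exact: (pickP (k.+1, _)).2].
move=> k; have [le1 _] := pickP (k.+1, bump (alpha k)).
have [le2 nle] := bumpP (alpha k).
split; first exact: trans le1.
by move=> /nle{}nle le3; apply/nle/(trans _ _ _ le1).
Qed.

Context (w : A -> seq (R * nat)) (N : nat -> nat) (c : nat -> nat -> nat).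
Hypothesis w_convex : forall a, convex_weights (w a).
Hypothesis cN : forall j n, (c j n < N j)%N.

(** The weight that [w a] gives to the [i]-th cell of the [j]-th partition; [c j n] names the cell
    of [n]. *)
Let cell a (ji : nat * nat) := mean (w a) (fun n => (c ji.1 n == ji.2)%:R).

Let close (mu : nat * nat -> R) k : set A :=
  [set a | forall j i, (j < k)%N -> (i < k)%N -> `|cell a (j, i) - mu (j, i)| < k.+1%:R^-1].

(** The weights lie in a product of copies of [0, 1], compact by Tychonoff's theorem, and
    [close mu k] restricts only finitely many of them. *)
Let cluster_point : exists mu, forall k a, exists2 b, le a b & close mu k b.
Proof.
have PF := tails_filter dir.
have cK := @tychonoff (nat * nat)%type (fun=> R) (fun=> `[0, 1]%classic)
  (fun=> @segment_compact R 0 1).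
have [|mu [_ mucl]] := cK (cell @ tails le) (fmap_proper_filter cell PF).
  apply: (@filterE _ (tails le)) => a ji /=; rewrite in_itv /=.
  exact: mean_indic_itv.
exists mu => k a; pose E := prod_topology (fun _ : nat * nat => R).
pose near_mu (ji : 'I_k * 'I_k) : set E := proj (val ji.1, val ji.2) @^-1`
  ball (mu (val ji.1, val ji.2)) k.+1%:R^-1.
have muB : nbhs (mu : E) [set nu | forall ji, near_mu ji nu].
  apply: (@filter_forall _ _ near_mu (nbhs (mu : E))) => ji.
  have k0 : (0 : R) < k.+1%:R^-1 by rewrite invr_gt0.
  exact: (@proj_continuous (nat * nat)%type (fun=> R) _ (mu : E) _ (nbhsx_ballx _ _ k0)).
have aF : (cell @ tails le) (cell @` [set b | le a b]).
  by exists a => // b ab; exists b.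
have [_ [[b ab <-] Bb]] := mucl _ _ aF muB.
exists b => // j i jk ik; have := Bb (Ordinal jk, Ordinal ik).
by rewrite /near_mu /ball /= distrC.
Qed.

(** [S] is the mean computed from the weights [mu]. Half of the error comes from making [G] constant
    on cells, half from the deviation of the weights. *)
Let close_mean mu G (eps : R) : 0 < eps ->
  (exists j, forall n, `|G n - G (c j n)| <= eps / 2) ->
  exists S, exists k0, forall k a, (k0 <= k)%N -> close mu k a -> `|mean (w a) G - S| < eps.
Proof.
move=> e0 [j Gj]; pose S := \sum_(i < N j) G i * mu (j, i : nat).
pose D := \sum_(i < N j) `|G i|.
have D0 : 0 <= D by exact: sumr_ge0.
(* Such a [k] controls all cells of partition [j] and makes [D / k.+1 < eps / 2]. *)
exists S; exists (maxn (maxn j.+1 (N j)) (Num.truncn (D / (eps / 2)))).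
move=> k a; rewrite !geq_max => /andP[/andP[jk Nk] Dk] ak.
have : `|mean (w a) (fun n => G (c j n)) - S| < eps / 2.
  rewrite (mean_cells _ _ (cN j)) -sumrB (le_lt_trans (ler_norm_sum _ _ _))//.
  apply: (@le_lt_trans _ _ (D * k.+1%:R^-1)).
    rewrite mulr_suml; apply: ler_sum => i _; rewrite -mulrBr normrM ler_wpM2l//.
    by apply/ltW/ak => //; exact: leq_trans Nk.
  rewrite ltr_pdivrMr// mulrC -ltr_pdivrMr ?divr_gt0//.
  by apply: (lt_le_trans (truncnS_gt _)); rewrite ler_nat ltnS.
move=> near_S; have near_G := mean_dist (w_convex a) Gj.
rewrite -(subrKA (mean (w a) (fun n => G (c j n)))) (splitr eps).
by rewrite (le_lt_trans (ler_normD _ _))// ler_ltD.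
Qed.

(* The means of a function that is almost constant on cells are determined, up
   to eps, by the weights of finitely many cells; hence it suffices to make the
   countably many cell weights converge. *)
Lemma mean_subsequence : exists alpha : nat -> A, subsequence_indices le alpha /\
  forall G : nat -> R,
    (forall eps, 0 < eps -> exists j, forall n, `|G n - G (c j n)| <= eps) ->
    (exists L, mean (w (alpha k)) G @[k --> \oo] --> (L : R)) /\
    (mean (w a) G @[a --> tails le] --> (0 : R) ->
     mean (w (alpha k)) G @[k --> \oo] --> (0 : R)).
Proof.
have [mu freq] := cluster_point.
have [alpha [alpha_sub alpha_close]] := frequent_subsequence freq.
exists alpha; split=> // G Gc.
have app eps (e0 : 0 < eps) := close_mean mu e0 (Gc _ (divr_gt0 e0 (ltr0Sn R 1))).
split.
  (* [S] depends on [eps], so the limit comes from the Cauchy criterion. *)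
  apply/cvg_ex/cauchy_cvgP/cauchy_exP => eps e0.
  have [S [k0 Sk]] := app _ e0; exists S; exists k0 => // k /= kk0.
  by rewrite /ball /= distrC; apply: (Sk k).
have PF := tails_filter dir.
(* The subsequence need not be cofinal in [A], so it does not simply inherit the limit 0. An index
   [b] both far along the net and close to [mu] shows that [S] is within [2 * eps / 3] of 0. *)
move=> /cvgrPdist_lt G_cvg0; apply/cvgrPdist_lt => eps e0.
have e3 : 0 < eps / 3 by rewrite divr_gt0.
have [S [k0 Sk]] := app _ e3.
have [a _ Ha] := G_cvg0 _ e3; have [b ab bk] := freq k0 a.
have {Ha} := Ha _ ab; rewrite /= sub0r normrN => mb.
have {}bk := Sk _ _ (leqnn _) bk.
exists k0 => // k /= kk0; rewrite sub0r normrN.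
have := Sk _ _ kk0 (alpha_close k).
by move: mb bk => /=; rewrite !ltr_norml; lra.
Qed.

End selection.

(** * Elements of the convex hull as means *)

Section hull.
Context (R : realType) (s : scalar_kind) (Omega : topologicalType).
Local Notation K := (scalars R s).
Context (phi : Omega -> Omega) (hphi : continuous phi).
Local Notation X := (contfun K Omega).
Local Notation U := (koopman hphi : X -> X).

Lemma hull_mean (T : dual K Omega -> dual K Omega) : G0 hphi T ->
  exists l : seq (R * nat), convex_weights l /\
    forall y x, T y x = \sum_(q <- l) embed q.1 * y (iter q.2 U x).
Proof.
move=> [n [c [v [c0 c1 vV ->]]]].
have /choice[p pP] i : exists p, iter p (koopman_adjoint hphi) = v i.
  by have [p _ <-] := vV i; exists p.
exists [seq (part false (c i), p i) | i <- index_enum 'I_n]; split; first split.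
- by move=> _ /mapP[i _ ->]; rewrite -(@ler_embed R s) -embed_part// embed0.
- by rewrite big_map -(big_morph (part false) (@partD R s false) (part0 R s false)) c1 part1.
move=> y x; rewrite big_map.
rewrite (big_morph (fun S : dual K Omega -> dual K Omega => S y x : K)
  (id1 := 0) (op1 := +%R))//.
apply: eq_bigr => i _; rewrite -embed_part//.
by rewrite -iter_koopman_adjoint pP.
Qed.

Context (l : seq (R * nat)) (T : dual K Omega -> dual K Omega).
Hypothesis l_convex : convex_weights l.
Hypothesis TE : forall y x, T y x = \sum_(q <- l) embed q.1 * y (iter q.2 U x).

Lemma part_hull i y x : part i (T y x) = mean l (fun n => part i (y (iter n U x))).
Proof.
rewrite TE (big_morph (part i) (@partD R s i) (part0 R s i)).
by apply: eq_bigr => q _; rewrite part_embedM.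
Qed.

Lemma hull_linear x : linear (fun y => T y x : K^o).
Proof.
move=> a y z; rewrite !TE scaler_sumr -big_split; apply: eq_bigr => q _ /=.
by rewrite -[_ *: (_ * _)]/(_ * (_ * _)) mulrCA -mulrDr.
Qed.

(** The iterates of [U] do not increase the sup norm and the weights sum to 1, so one bound serves
    the whole hull. *)
Lemma hull_bound y x b d : dual_norm_le y b -> sup_norm_le x d -> `|T y x| <= b * d.
Proof.
move=> [b0 yb] [d0 xd]; have [l0 l1] := l_convex.
rewrite TE (le_trans (ler_norm_sum _ _ _))// -[leRHS]mul1r -(@embed1 R s) -l1.
rewrite (big_morph (@embed R s) (@embedD R s) (@embed0 R s)) mulr_suml.
rewrite big_seq [leRHS]big_seq; apply: ler_sum => q ql.
rewrite normrM embed_norm (ger0_norm (l0 _ ql)) ler_wpM2l//.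
  by rewrite -(@embed0 R s) ler_embed l0.
by apply: yb; split=> // w; rewrite iter_koopman.
Qed.

End hull.

(** * Limit operators and the conclusion *)

Lemma cvg_norm_bound (K : numFieldType) (u : nat -> K) (l C : K) :
  (u n : K^o) @[n --> \oo] --> (l : K^o) -> (forall n, `|u n| <= C) -> `|l| <= C.
Proof.
move=> /cvgrPdist_lt ul uC; apply/ler_addgt0Pr => e /ul[n _ /(_ n (leqnn n)) /= ln].
by rewrite -(subrK (u n) l) addrC (le_trans (ler_normD _ _))// lerD// ltW.
Qed.

(** Linearity passes to the limit by uniqueness of limits. The uniform bound [b * d] passes too,
    making each [L y] a bounded functional and [Q] a contraction. *)
Lemma End_dual_limit (K : numFieldType) (Omega : topologicalType)
    (T : nat -> dual K Omega -> dual K Omega) (L : dual K Omega -> contfun K Omega -> K) :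
  (forall k x, linear (fun y => T k y x : K^o)) ->
  (forall k y x b d, dual_norm_le y b -> sup_norm_le x d -> `|T k y x| <= b * d) ->
  (forall y x, (T k y x : K^o) @[k --> \oo] --> (L y x : K^o)) ->
  exists2 Q : dual K Omega -> dual K Omega, End_dual Q & WO_cvg \oo T Q.
Proof.
move=> Tlin Tb TL.
have Lb y x b d : dual_norm_le y b -> sup_norm_le x d -> `|L y x| <= b * d.
  by move=> yb xd; apply: cvg_norm_bound (TL y x) _ => k; exact: Tb.
have Lunique u (a b : K^o) : (u : nat -> K^o) @ \oo --> a -> u @ \oo --> b -> a = b.
  by apply: cvg_unique; exact: norm_hausdorff.
have LP y : (L y : contfun K Omega -> K^o) \in @dual_pred K Omega.
  apply/asboolP; split.
    move=> a u v; apply: (Lunique _ _ _ (TL y _)).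
    under eq_fun do rewrite dual_linear.
    by apply: cvgD; [apply: cvgZr|]; exact: TL.
  have /asboolP[_ [c yc]] := dualP y; exists c; split; first by have [] := yc.
  by move=> x b xb; exact: (Lb y x c b yc xb).
exists (fun y => Dual (LP y)); last by move=> x y; exact: (TL y x).
split=> [a y z|].
  apply: val_inj; apply/funext => x /=.
  apply: (Lunique _ _ _ (TL _ x)); under eq_fun do rewrite Tlin.
  by apply: cvgD; [apply: cvgZr|]; exact: TL.
exists 1; split=> // y b yb; rewrite mul1r; split; first by have [] := yb.
by move=> x d; exact: Lb.
Qed.

Theorem theorem3p1 (R : realType) (s : scalar_kind)
    (Omega : topologicalType) (Omega_compact : compact [set: Omega])
    (Omega_metrizable : metrizable R Omega)
    (phi : Omega -> Omega) (hphi : continuous phi)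
    (hordinary : ordinary phi R)
    (A : Type) (le : A -> A -> Prop) (hdirected : directed le)
    (T : A -> dual (scalars R s) Omega -> dual (scalars R s) Omega)
    (hT : forall a, G0 hphi (T a))
    (hergodic : ergodic hphi (tails le) T) :
  exists alpha : nat -> A,
    [/\ subsequence_indices le alpha,
        ergodic hphi \oo (fun k => T (alpha k))
      & exists2 Q : dual (scalars R s) Omega -> dual (scalars R s) Omega,
          End_dual Q & WO_cvg \oo (fun k => T (alpha k)) Q].
Proof.
have [M [e [ev [M_compact ev_continuous ev_e]]]] :=
  ordinary_compact_model Omega_compact hordinary.
have /choice[w wP] a := hull_mean (hT a).
have w_convex a : convex_weights (w a) by have [] := wP a.
have TE a := (wP a).2.
(* [c j n] is the representative of [n] at scale [1 / j.+1], and labels its cell. *)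
have /choice[N /choice[c cP]] j : exists N, exists c, forall n,
    (c n < N)%N /\ ball (e n) j.+1%:R^-1 (e (c n)).
  have j0 : (0 : R) < j.+1%:R^-1 by rewrite invr_gt0.
  have [N HN] := compact_totally_bounded_seq M_compact e j0; exists N.
  have /choice[c cP] n : exists n', (n' < N)%N /\ ball (e n) j.+1%:R^-1 (e n').
    by have [n' ? ?] := HN n; exists n'.
  by exists c.
have cN j n : (c j n < N j)%N by have [] := cP j n.
have [alpha [alpha_sub alphaP]] := mean_subsequence hdirected w_convex cN.
have Gc i (y : dual (scalars R s) Omega) x (eps : R) : 0 < eps -> exists j, forall n,
    `|part i (y (iter n (koopman hphi) x)) -
      part i (y (iter (c j n) (koopman hphi) x))| <= eps.
  move=> eps0; have [d d0 dP] := orbit_unif_continuous Omega_compact hphi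
    M_compact ev_continuous ev_e y x i eps0.
  have [j _ /(_ j (leqnn j)) /= jd] := near_infty_natSinv_lt (PosNum d0).
  exists j => n; apply/ltW/dP; have [_] := cP j n; apply: le_ball; exact: ltW.
exists alpha; split=> //.
  (* Ergodicity says that [T a z x] tends to 0 along the net; the second half of [alphaP] carries
     this over to the subsequence. *)
  move=> x y; pose z := (id - koopman_adjoint hphi : _ -> dual (scalars R s) Omega) y.
  have Tz : (T a z x : (scalars R s)^o) @[a --> tails le] --> (0 : (scalars R s)^o) :=
    hergodic x y.
  suff : (T (alpha k) z x : (scalars R s)^o) @[k --> \oo] -->
      (embed 0 + imag * embed 0 : (scalars R s)^o).
    by rewrite embed0 mulr0 addr0.
  apply: (parts_cvg (l := fun=> 0)) => i.
  under eq_fun do rewrite /= (part_hull (TE _)).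
  apply: (alphaP _ (Gc i z x)).2.
  have PF := tails_filter hdirected.
  have := part_cvg (i := i) Tz; rewrite part0.
  by under eq_fun do rewrite /= (part_hull (TE _)); exact.
(* One subsequence serves all pairs [(y, x)], since [alphaP] holds for every suitable [G]. *)
have /choice[L LP] (yx : dual (scalars R s) Omega * contfun (scalars R s) Omega) :
    exists L : scalars R s,
      (T (alpha k) yx.1 yx.2 : (scalars R s)^o) @[k --> \oo] --> (L : (scalars R s)^o).
  case: yx => y x /=.
  have /choice[l lP] i := (alphaP _ (Gc i y x)).1.
  exists (embed (l false) + imag * embed (l true)); apply: parts_cvg => i.
  by under eq_fun do rewrite (part_hull (TE _)); exact: lP.
apply: (@End_dual_limit _ _ _ (fun y x => L (y, x))).
- by move=> k x; exact: hull_linear (TE _) x.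
- by move=> k y x b d; exact: (hull_bound (w_convex _) (TE _)).
- by move=> y x; exact: (LP (y, x)).
Qed.
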